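(* There are absolute constants $c_1, c_2, c_3 > 0$ such that $c_1 D^2 \le \mathcal{T}(D)$ for every integer $D \ge 1$, and $\mathcal{T}(D) \le c_2 \exp\left(c_3 \sqrt{D}\, \log D\, \sqrt{\log\log D}\right)$ for every integer $D \ge 3$.
   Context: For subsets $A, B, E$ of $\mathbb{Z}$, write $A \oplus B = E$ (a tiling of $E$ by $A$ with $B$) if every sum $a+b$ ($a\in A$, $b\in B$) lies in $E$ and every $g \in E$ has a unique representation $g = a+b$ with $a \in A$, $b \in B$. A set $B \subseteq \mathbb{Z}$ is periodic if there is $t \in \mathbb{Z}\setminus\{0\}$ with $B = B+t$; in that case $\mathcal{P}(B)$ denotes the least $t>0$ with $B = B+t$. It is a known fact that if $A \subseteq \mathbb{Z}$ is finite and $A \oplus B = \mathbb{Z}$ then $B$ is periodic (and $\mathcal{P}(B) \le 2^{d}$, where $d = \max A - \min A$ is the diameter of $A$). For a positive integer $D$, $\mathcal{T}(D)$ denotes the largest integer $k$ such that there exist $A \subseteq \{0,1,\ldots,D\}$ and $B \subseteq \mathbb{Z}$ with $A \oplus B = \mathbb{Z}$ and $\mathcal{P}(B) \ge k$. Here $\log$ is the natural logarithm. *)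

(* Defs.v *)
From HB Require Import structures.
From mathcomp Require Import all_boot all_order all_algebra.
From mathcomp Require Import all_classical all_reals all_analysis.

Set Implicit Arguments.
Unset Strict Implicit.
Unset Printing Implicit Defensive.

Import Order.TTheory GRing.Theory Num.Theory.
Local Open Scope classical_set_scope.
Local Open Scope ring_scope.

Definition tiling (A B E : set int) : Prop :=
  (forall a b : int, A a -> B b -> E (a + b)) /\
  (forall g : int, E g ->
     exists! ab : int * int, [/\ A ab.1, B ab.2 & g = ab.1 + ab.2]).

Definition is_translation_period (B : set int) (t : int) : Prop :=
  B = [set b + t | b in B].

Definition is_least_period (B : set int) (t : nat) : Prop :=
  [/\ (0 < t)%N, is_translation_period B t%:Z &
      forall s : nat, (0 < s)%N -> is_translation_period B s%:Z -> (t <= s)%N].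

(* P(B). The default 0 is returned exactly when B is not periodic; this does not
   happen for the translation set B of a tiling of Z by a finite set. *)
Definition least_period (B : set int) : nat := xget 0%N (is_least_period B).

Definition period_bounds (D : nat) : set nat :=
  [set k | exists A B : set int,
     [/\ A `<=` [set a : int | 0 <= a <= D%:Z],
         tiling A B [set: int] &
         (k <= least_period B)%N]].

(* T(D): the maximum of period_bounds D, with default value 0 if there were none.
   Since 1 belongs to period_bounds D (take A = {0}, B = Z), the maximum is the same
   over nat as over int, and is positive. So a positive lower bound on
   max_period D says in particular that the maximum exists. *)
Definition max_period (D : nat) : nat :=
  xget 0%N [set k | period_bounds D k /\
                    forall j : nat, period_bounds D j -> (j <= k)%N].

(* Main.v *)
(* Upper bound. Let M be the least period of B. For every prime p | M a Fourier
   argument on Z/M gives some d_p | M with the full p-part of M such that A(X)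
   vanishes at the primitive d_p-th roots of unity. The distinct cyclotomic
   polynomials Phi_d, for d in T = {d_p : p | M}, all divide A(X), so the sum of
   phi(d) over T is at most D. Each d in T is d_p for some prime p, distinct d
   give distinct p, and phi(d) >= p - 1; hence |T| = O(sqrt D). Finally M divides
   the product of T, and d <= 2 phi(d)^2 <= 2 D^2, so M <= (2 D^2)^|T|. This is
   even slightly stronger than the stated bound.

   Lower bound. With a, b coprime, a odd and 3 not dividing b, the set
   {0, 3a} + {0, 2b, 4b} tiles Z with complements of least periods 6a and 6b
   (one progression fills the residues mod 2 or 3 and the other one tiles the
   multiples of 2 or 3). Dilating by 2, one may use the first complement on the
   even integers and the second one on the odd integers, so that every period of
   the result is a multiple of 6ab. *)

Require Import Defs.
From HB Require Import structures.
From mathcomp Require Import all_boot all_order all_algebra all_field.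
From mathcomp Require Import all_classical all_reals all_analysis.
From mathcomp Require Import zify ring lra.

Set Implicit Arguments.
Unset Strict Implicit.
Unset Printing Implicit Defensive.

Import Order.TTheory GRing.Theory Num.Theory.
Local Open Scope ring_scope.

(** * Totients, distinct primes and the size of M *)

Lemma leq_expn_totient p e :
  prime p -> (0 < e)%N ->
  (p ^ e <= (if p == 2 then 2 else 1) * (p.-1 * p ^ e.-1) ^ 2)%N.
Proof.
move=> p_pr; case: e => // e _ /=; rewrite expnS expnMn.
have pe_gt0 : (0 < p ^ e)%N by rewrite expn_gt0 prime_gt0.
move: pe_gt0 (prime_gt1 p_pr); move: (p ^ e)%N => q q_gt0 p_gt1.
case: eqP => [-> | p_neq2]; first by nia.
have p_le : (p <= p.-1 ^ 2)%N by nia.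
by rewrite mul1n; apply: leq_mul => //; nia.
Qed.

(** By multiplicativity this reduces to prime powers. Since p <= (p - 1)^2 for odd p, only p = 2
    costs a factor 2, so the product pays it at most once. *)
Lemma leq_totient_sqr n : (n <= 2 * totient n ^ 2)%N.
Proof.
have [-> // | n_gt0] := posnP n.
rewrite {1}(prod_prime_decomp n_gt0) prime_decompE big_map /= totientE //.
apply: (@leq_trans (\prod_(p <- primes n)
  ((if p == 2 then 2 else 1) * (p.-1 * p ^ (logn p n).-1) ^ 2))).
  rewrite big_seq [leqRHS]big_seq; apply: leq_prod => p p_n.
  apply: leq_expn_totient; last by rewrite logn_gt0.
  by move: p_n; rewrite mem_primes => /and3P[].
rewrite big_split /=; apply: leq_mul.
  rewrite -big_mkcond /= big_const_seq iter_muln_1.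
  rewrite count_uniq_mem ?primes_uniq //.
  by case: (_ \in _).
by rewrite expnS expn1 -big_split; apply: leq_prod => p _; rewrite expnS expn1.
Qed.

(** After sorting, the entry of index i is at least i. *)
Lemma leq_sum_uniq (s : seq nat) :
  uniq s -> (size s * (size s).-1 <= 2 * \sum_(x <- s) x)%N.
Proof.
move=> s_uniq; rewrite -(perm_big _ (permEl (perm_sort leq s))) /=.
rewrite -(size_sort leq s); set r := sort leq s.
have r_sorted : sorted ltn r.
  rewrite ltn_sorted_uniq_leq sort_uniq s_uniq /=.
  exact: (sort_sorted leq_total).
have le_nth i : (i < size r -> i <= nth 0 r i)%N.
  elim: i => // i IHi lt_i; apply: leq_ltn_trans (IHi (ltnW lt_i)) _.
  apply: (sorted_ltn_nth ltn_trans) => //; rewrite inE ?lt_i ?(ltnW lt_i) //.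
rewrite (big_nth 0) big_mkord.
have -> : (size r * (size r).-1 = 2 * \sum_(i < size r) i)%N.
  elim: (size r) => [|n IHn]; first by rewrite big_ord0.
  by rewrite big_ord_recr /= mulnDr -IHn; case: n {IHn} => //= n; lia.
rewrite leq_mul2l /=; apply: leq_sum => i _; apply/le_nth/ltn_ord.
Qed.

(** The two divisibility conditions say that [d p] carries the full p-part of [M]; [t] will be the
    number of distinct values of [d]. *)
Lemma leq_prod_full_divisors (M D : nat) (d : nat -> nat) :
    (0 < M)%N ->
    {in primes M, forall p, (d p %| M)%N /\ ~~ (d p %| M %/ p)%N} ->
    (\sum_(e <- undup [seq d p | p <- primes M]) totient e <= D)%N ->
  exists t, (t * t.-1 <= 2 * D)%N /\ (M <= (2 * D ^ 2) ^ t)%N.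
Proof.
move=> M_gt0 d_full; set T := undup _ => sumT.
have T_ex e : e \in T -> exists2 p, p \in primes M & e = d p.
  by rewrite mem_undup => /mapP.
have d_gt0 p : p \in primes M -> (0 < d p)%N.
  by case/d_full=> /dvdn_gt0 -> .
(* Otherwise p divides M / d p, and then d p divides M / p. *)
have full_logn p : p \in primes M -> logn p (d p) = logn p M.
  move=> pM; have [dM ndM] := d_full p pM.
  have := pM; rewrite mem_primes => /and3P[p_pr _ p_dv].
  apply/eqP; rewrite eqn_leq dvdn_leq_log //=; rewrite leqNgt.
  apply: contra ndM => lt_log.
  have [k Mk] := dvdnP dM.
  have k_gt0 : (0 < k)%N by move: M_gt0; rewrite Mk muln_gt0 => /andP[].
  have : (p %| k)%N.
    move: lt_log; rewrite Mk lognM ?d_gt0 // -[X in (X < _)%N]add0n ltn_add2r.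
    by rewrite logn_gt0 mem_primes => /and3P[].
  case/dvdnP => l kl; rewrite Mk kl -mulnA mulnCA mulKn ?prime_gt0 //.
  by rewrite dvdn_mull.
(* One prime is picked for each value of [d]; as d (q e) = e, distinct values get distinct
   primes. *)
pose q e := head 0 [seq p <- primes M | d p == e].
have qP e : e \in T -> q e \in primes M /\ d (q e) = e.
  case/T_ex=> p pM ->; rewrite /q.
  have : p \in [seq p0 <- primes M | d p0 == d p] by rewrite mem_filter eqxx.
  case E: [seq _ <- _ | _] => [//|r s] _ /=.
  have : r \in [seq p0 <- primes M | d p0 == d p] by rewrite E mem_head.
  by rewrite mem_filter => /andP[/eqP].
have q_tot e : e \in T -> ((q e).-1 <= totient e)%N.
  move=> eT; have [qM dq] := qP e eT.
  have := qM; rewrite mem_primes => /and3P[q_pr _ q_dv].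
  have e_gt0 : (0 < e)%N by rewrite -dq d_gt0.
  have log_gt0 : (0 < logn (q e) e)%N by rewrite -{2}dq full_logn // logn_gt0.
  rewrite -(totient_prime q_pr).
  rewrite -[X in (_ <= totient X)%N](partnC (q e) e_gt0).
  rewrite totient_coprime ?coprime_partC //.
  rewrite p_part totient_pfactor // totient_prime // -mulnA leq_pmulr //.
  by rewrite muln_gt0 expn_gt0 prime_gt0 // totient_gt0 part_gt0.
have size_T : (size T * (size T).-1 <= 2 * D)%N.
  rewrite -(size_map (fun e => (q e).-1)).
  apply: leq_trans (leq_sum_uniq _) _.
    rewrite map_inj_in_uniq ?undup_uniq // => e1 e2 eT1 eT2 eq_q.
    have [qM1 dq1] := qP e1 eT1; have [qM2 dq2] := qP e2 eT2.
    rewrite -dq1 -dq2; congr d.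
    move: qM1 qM2; rewrite !mem_primes.
    move=> /andP[/prime_gt0 q1 _] /andP[/prime_gt0 q2 _].
    by rewrite -(prednK q1) -(prednK q2) eq_q.
  rewrite leq_mul2l big_map /=; apply: leq_trans sumT.
  by rewrite [leqLHS]big_seq [leqRHS]big_seq; apply: leq_sum.
exists (size T); split => //.
(* Divisibility is tested on each p-part of [M], which divides the factor [d p]. *)
apply: (@leq_trans (\prod_(e <- T) e)).
  apply: dvdn_leq.
    rewrite big_seq; apply: prodn_cond_gt0 => e /T_ex[p pM ->]; exact: d_gt0.
  apply/dvdn_partP => // p; rewrite p_part => pM.
  have dT : d p \in T by rewrite mem_undup map_f.
  rewrite -(full_logn p pM); apply: dvdn_trans (pfactor_dvdnn _ _) _.
  by rewrite (big_rem _ dT) /= dvdn_mulr.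
have -> : ((2 * D ^ 2) ^ size T = \prod_(e <- T) (2 * D ^ 2))%N.
  rewrite big_const_seq count_predT.
  by elim: (size T) => //= n <-; rewrite expnS.
rewrite big_seq [leqRHS]big_seq; apply: leq_prod => e eT.
apply: leq_trans (leq_totient_sqr e) _; rewrite leq_mul2l /= leq_exp2r //.
by apply: leq_trans sumT; rewrite (big_rem _ eT) /= leq_addr.
Qed.

(** * Cyclotomic factors of a rational polynomial *)

Lemma coprimep_prod (F : fieldType) (I : eqType) (s : seq I)
    (f : I -> {poly F}) (p : {poly F}) :
  {in s, forall i, coprimep p (f i)} -> coprimep p (\prod_(i <- s) f i).
Proof.
elim: s => [|i s IHs] co; first by rewrite big_nil coprimep1.
rewrite big_cons coprimepMr co ?mem_head // IHs // => j js.
by rewrite co // in_cons js orbT.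
Qed.

Lemma coprimep_cyclotomic (d e : nat) (z w : algC) :
  d.-primitive_root z -> e.-primitive_root w -> d != e ->
  coprimep (cyclotomic z d) (cyclotomic w e).
Proof.
move=> prim_z prim_w neq_de; apply/Pdiv.ClosedField.coprimepP => x.
rewrite root_cyclotomic // => prim_d; rewrite -rootE root_cyclotomic //.
apply: contra neq_de => prim_e.
by rewrite eqn_dvd (prim_order_dvd prim_d) (prim_order_dvd prim_e)
  (prim_expr_order prim_d) (prim_expr_order prim_e) eqxx.
Qed.

(** The minimal polynomial of a primitive d-th root over the rationals is the d-th cyclotomic
    polynomial. These are pairwise coprime, so their product divides [p], and degrees are
    compared. *)
Lemma leq_sum_totient (p : {poly rat}) (T : seq nat) :
    p != 0 -> uniq T ->
    {in T, forall d, exists2 z : algC,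
       d.-primitive_root z & root (map_poly ratr p) z} ->
  (\sum_(d <- T) totient d < size p)%N.
Proof.
move=> p_neq0 T_uniq T_root.
(* The order [d.-1.+1] is visibly positive and equals [d] for [d] in [T]. *)
pose zeta d := sval (C_prim_root_exists (ltn0Sn d.-1)).
have zetaP d : d \in T -> d.-primitive_root (zeta d).
  case/T_root=> z /prim_order_gt0 d_gt0 _; rewrite /zeta.
  by case: C_prim_root_exists => w /=; rewrite prednK.
have dvd_p d : d \in T -> cyclotomic (zeta d) d %| map_poly ratr p.
  move=> dT; have [z prim_z p_z] := T_root d dT.
  rewrite -(Cintr_Cyclotomic (zetaP d dT)) (Cintr_Cyclotomic prim_z).
  rewrite -(minCpoly_cyclotomic prim_z).
  have [q [-> _ q_min]] := minCpolyP z.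
  by rewrite dvdp_map -q_min.
have : \prod_(d <- T) cyclotomic (zeta d) d %| map_poly (ratr : rat -> algC) p.
  elim: T T_uniq {T_root} zetaP dvd_p => [|d T IHT] /=.
    by rewrite big_nil dvd1p.
  case/andP=> d_notin T_uniq zetaP dvd_p.
  have sub e : e \in T -> e \in d :: T by rewrite in_cons orbC => ->.
  rewrite big_cons Gauss_dvdp.
    by rewrite dvd_p ?mem_head //= IHT // => e /sub; auto.
  apply: coprimep_prod => e eT.
  apply: coprimep_cyclotomic (zetaP _ _) (zetaP _ _) _.
  - exact: mem_head.
  - exact: sub.
  - by apply: contraNneq d_notin => ->.
move/dvdp_leq; rewrite map_poly_eq0 p_neq0 => /(_ isT); rewrite size_map_poly.
apply: leq_trans; elim: (T) => [|d s IHs]; first by rewrite !big_nil size_poly1.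
have cyc_neq0 e : cyclotomic (zeta e) e != 0.
  exact/monic_neq0/cyclotomic_monic.
rewrite !big_cons size_mul ?cyc_neq0 // ?size_cyclotomic; last by
  rewrite prodf_seq_neq0; apply/allP => e _; apply: cyc_neq0.
by rewrite addSn -addnS leq_add2l.
Qed.

(** * Periods and Fourier analysis on Z/M *)

Lemma translation_periodP (B : set int) (t : int) :
  is_translation_period B t <-> forall x, B x <-> B (x - t).
Proof.
rewrite /is_translation_period; split=> [BE x | Bt].
  split=> Bx; first by move: Bx; rewrite {1}BE => -[b Bb <-]; rewrite addrK.
  by rewrite BE; exists (x - t) => //; rewrite subrK.
apply/seteqP; split=> [x Bx | _ [b Bb <-]].
  by exists (x - t); [apply: (proj1 (Bt x)) | rewrite subrK].
by apply/Bt; rewrite addrK.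
Qed.

Lemma periodic_modz (T : Type) (f : int -> T) (M : int) :
  (forall x, f (x - M) = f x) -> forall x, f x = f (x %% M)%Z.
Proof.
move=> f_per x.
have f_mul (n : nat) y : f (y - n%:Z * M) = f y.
  elim: n y => [|n IHn] y; first by rewrite mul0r subr0.
  by rewrite -[n.+1]addn1 PoszD mulrDl mul1r opprD addrA f_per IHn.
rewrite {1}(divz_eq x M) addrC; case: (x %/ M)%Z => n.
  by rewrite -(f_mul n) addrK.
by rewrite NegzE mulNr f_mul.
Qed.

(** The polynomial A(X), over the rationals so that one primitive d-th root of unity as a root
    brings in the whole cyclotomic factor. *)
Definition mask (D : nat) (A : set int) : {poly rat} :=
  \poly_(i < D.+1) (asbool (A i%:Z))%:R.

(** For [f] of period [M] and z ^+ M = 1 this is a Fourier coefficient on Z/M, with [z] standing for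
    the character. *)
Definition dft (M : nat) (f : int -> algC) (z : algC) : algC :=
  \sum_(x < M) f x%:Z * z ^+ x.

Lemma dft_shift (M : nat) (f : int -> algC) (z : algC) (i : nat) :
    (0 < M)%N -> (forall x, f (x - M%:Z) = f x) -> z ^+ M = 1 ->
  dft M (fun x => f (x - i%:Z)) z = z ^+ i * dft M f z.
Proof.
move=> M_gt0 f_per zM; elim: i f f_per => [|i IHi] f f_per.
  by rewrite mul1r; apply: eq_bigr => x _; rewrite subr0.
have := IHi (fun x => f (x - 1)) => H.
rewrite (_ : (fun x => _) = fun x => f (x - i%:Z - 1)); last first.
  by apply/funext => x; congr f; lia.
rewrite H => [{H}|x]; last by rewrite -[RHS]f_per; congr f; lia.
rewrite exprSr -mulrA; congr (_ * _); rewrite /dft.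
case: M M_gt0 f_per zM {IHi} => // m _ f_per zM.
(* The term f(-1) of the shifted sum wraps around to the last term of the other sum. *)
rewrite big_ord_recl [in RHS]big_ord_recr /= mulrDr addrC; congr (_ + _).
  rewrite mulr_sumr; apply: eq_bigr => x _; rewrite exprS mulrCA.
  by congr (_ * (f _ * _)); rewrite /bump /=; lia.
by rewrite mulrCA -exprS zM expr0 !mulr1 -[RHS]f_per; congr f; lia.
Qed.

(** Otherwise a nonzero polynomial of degree below [M], with the values of [f] as coefficients,
    would have all M-th roots of unity as roots. *)
Lemma dft_neq0 (M : nat) (f : int -> algC) (x0 : int) :
    (0 < M)%N -> (forall x, f (x - M%:Z) = f x) -> f x0 != 0 ->
  exists2 z, z ^+ M = 1 & dft M f z != 0.
Proof.
move=> M_gt0 f_per f_x0; have [w prim_w] := C_prim_root_exists M_gt0.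
pose p := \poly_(x < M) f x%:Z.
have p_neq0 : p != 0.
  apply: contraNneq f_x0 => p0.
  have := congr1 (fun q : {poly algC} => q`_(`|(x0 %% M%:Z)%Z|)%N) p0.
  rewrite coef0 coef_poly ifT; last by lia.
  by rewrite gez0_abs ?modz_ge0 -?periodic_modz ?lt0r_neq0 // => ->.
pose rs := [seq w ^+ i | i <- iota 0 M].
have rs_uniq : uniq rs.
  rewrite map_inj_in_uniq ?iota_uniq // => i j.
  rewrite !mem_iota /= !add0n => lt_iM lt_jM /eqP.
  by rewrite (eq_prim_root_expr prim_w) !modn_small // => /eqP.
have [p_rs | /allPn[_ /mapP[i _ ->] p_wi]] := boolP (all (root p) rs).
  have := max_poly_roots p_neq0 p_rs rs_uniq.
  by rewrite size_map size_iota ltnNge size_poly.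
exists (w ^+ i); last by move: p_wi; rewrite rootE horner_poly.
by rewrite -exprM mulnC exprM (prim_expr_order prim_w) expr1n.
Qed.

(** Only the index i = a from the unique representation g = a + b contributes. *)
Lemma tiling_sum_indicator (D : nat) (A B : set int) (g : int) :
    (A `<=` [set a : int | 0 <= a <= D%:Z])%classic -> tiling A B setT ->
  \sum_(i < D.+1) (asbool (A i%:Z))%:R * (asbool (B (g - i%:Z)))%:R = 1 :> algC.
Proof.
move=> A_le [_ /(_ g I)[[a b] [[/= Aa Bb g_ab] ab_uniq]]].
move: g_ab => /= g_ab; subst g; have := A_le a Aa => /= a_bnd.
have a_lt : (`|a|%N < D.+1)%N by lia.
have a_abs : `|a|%N%:Z = a by lia.
rewrite (bigD1 (Ordinal a_lt)) //= a_abs addrAC subrr add0r !asboolT //.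
rewrite mulr1 big1 ?addr0 // => i ne_ia.
case: (asboolP (A _)) => [Ai|]; last by rewrite mul0r.
case: (asboolP (B _)) => [Bi|]; last by rewrite mulr0.
have /(congr1 fst) /= ai : (a, b) = (i%:Z, a + b - i%:Z).
  by apply: ab_uniq; split=> //=; lia.
by case/eqP: ne_ia; apply: val_inj => /=; lia.
Qed.

(* If [B] has period [M] but not [M %/ p], then [b - b (_ - M %/ p)] has a
   nonzero Fourier coefficient on Z/M; there the transform of [b] is nonzero, so
   that of [A] vanishes because the convolution of [A] and [B] is constant. *)
Lemma full_order_root (D M p : nat) (A B : set int) :
    (A `<=` [set a : int | 0 <= a <= D%:Z])%classic -> tiling A B setT ->
    (0 < M)%N -> is_translation_period B M%:Z ->
    ~ is_translation_period B (M %/ p)%:Z ->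
  exists d, [/\ d %| M, ~~ (d %| M %/ p) & exists2 z : algC,
    d.-primitive_root z & root (map_poly ratr (mask D A)) z]%N.
Proof.
move=> A_le AB M_gt0 /translation_periodP B_M B_Mp.
pose b x : algC := (asbool (B x))%:R.
have b_M x : b (x - M%:Z) = b x.
  by rewrite /b (asbool_equiv_eq (B_M x)).
pose m := (M %/ p)%N; pose c x := b x - b (x - m%:Z).
have c_M x : c (x - M%:Z) = c x by rewrite /c b_M addrAC b_M.
have [x0 c_x0] : exists x0, c x0 != 0.
  apply: contrapT => c0; apply: B_Mp; apply/translation_periodP => x.
  have : c x = 0 by apply/eqP; apply: contraT => cx; case: c0; exists x.
  move/eqP; rewrite subr_eq0 eqr_nat => /eqP.
  by case: asboolP => Bx; case: asboolP => Bx'.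
have [z zM] := dft_neq0 M_gt0 c_M c_x0.
have -> : dft M c z = (1 - z ^+ m) * dft M b z.
  rewrite mulrBl mul1r -dft_shift // /dft -sumrB.
  by apply: eq_bigr => x _; rewrite mulrBl.
(* Both factors are nonzero; z ^+ m != 1 says that the order of [z] does not divide M / p. *)
rewrite mulf_eq0 negb_or subr_eq0 eq_sym => /andP[zm b_z].
have [d prim_z d_M] := prim_order_exists M_gt0 zM.
exists d; split=> //; first by rewrite (prim_order_dvd prim_z).
exists z => //; rewrite rootE; apply: contraT => A_z.
have z_neq1 : z != 1 by apply: contraNneq zm => ->; rewrite expr1n.
have : (map_poly ratr (mask D A)).[z] * dft M b z == 0.
  have -> : map_poly ratr (mask D A) =
      \poly_(i < D.+1) (asbool (A i%:Z))%:R :> {poly algC}.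
    apply/polyP => i; rewrite coef_map !coef_poly /=.
    by case: ifP; rewrite ?rmorph0 ?rmorph_nat.
  rewrite horner_poly mulr_suml.
  under eq_bigr => i _ do rewrite -mulrA -dft_shift // /dft mulr_sumr.
  rewrite exchange_big /=.
  under eq_bigr => x _.
    under eq_bigr => i _ do rewrite mulrA.
    rewrite -mulr_suml tiling_sum_indicator // mul1r.
    over.
  (* What remains is the geometric sum of the powers of [z], zero because z != 1. *)
  have := subrX1 z M; rewrite zM subrr => /esym/eqP.
  by rewrite mulf_eq0 subr_eq0 (negPf z_neq1).
by rewrite mulf_eq0 (negPf A_z) (negPf b_z).
Qed.

(** * Tilings with complements of large period *)

Section Periods.

Local Open Scope classical_set_scope.

Lemma tiling_sumset (X Y F C E : set int) :
  tiling X C E -> tiling Y F C -> tiling [set x + y | x in X & y in Y] F E.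
Proof.
move=> [XC_E XC_ex] [YF_C YF_ex]; split=> [_ f [x Xx [y Yy <-]] Ff | g Eg].
  by rewrite -addrA; apply/XC_E/YF_C.
have [[x c] [[/= Xx Cc gE] xc_uniq]] := XC_ex g Eg.
have [[y f] [[/= Yy Ff cE] yf_uniq]] := YF_ex c Cc.
exists (x + y, f); split=> [|[_ f'] [/= [x' Xx' [y' Yy' <-]] Ff' gE']].
  by split=> //=; [exists x => //; exists y | rewrite gE cE addrA].
have [-> c_eq] : (x, c) = (x', y' + f').
  by apply: xc_uniq; split=> //=; [apply: YF_C | rewrite gE' addrA].
by have [-> ->] : (y, f) = (y', f') by apply: yf_uniq; split.
Qed.

Lemma tiling_scale (k : int) (A B E : set int) : k != 0 ->
  tiling A B E ->
  tiling [set k * a | a in A] [set k * b | b in B] [set k * e | e in E].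
Proof.
move=> k_neq0 [AB_E AB_ex]; split=> [_ _ [a Aa <-] [b Bb <-] | _ [g Eg <-]].
  by exists (a + b); [apply: AB_E | rewrite mulrDr].
have [[a b] [[/= Aa Bb gE] ab_uniq]] := AB_ex g Eg.
exists (k * a, k * b); split.
  by split=> /=; [exists a | exists b | rewrite gE mulrDr].
move=> [_ _] [/= [a' Aa' <-] [b' Bb' <-] /eqP].
rewrite -mulrDr (inj_eq (mulfI k_neq0)) => /eqP gE'.
by have [-> ->] : (a, b) = (a', b') by apply: ab_uniq; split.
Qed.

(** The dilated set is even, so the parity of g decides which complement is used; the two may be
    chosen independently. *)
Lemma tiling_even_odd (A B0 B1 : set int) :
    tiling A B0 setT -> tiling A B1 setT ->
  tiling [set 2 * a | a in A]
    ([set 2 * b | b in B0] `|` [set 2 * b + 1 | b in B1]) setT.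
Proof.
move=> [_ AB0] [_ AB1]; split=> // g _.
have [[h gE]|[h gE]] : (exists h, g = 2 * h) \/ (exists h, g = 2 * h + 1).
  have [?|?] : (g %% 2)%Z = 0 \/ (g %% 2)%Z = 1 by lia.
  - by left; exists (g %/ 2)%Z; lia.
  - by right; exists (g %/ 2)%Z; lia.
- have [[a b] [[/= Aa Bb hE] ab_uniq]] := AB0 h I.
  exists (2 * a, 2 * b); split.
    by split=> /=; [exists a | left; exists b | lia].
  move=> [_ _] [/= [a' Aa' <-] [] [b' Bb' <-] gE']; last by exfalso; lia.
  by have [-> ->] : (a, b) = (a', b') by apply: ab_uniq; split=> //=; lia.
- have [[a b] [[/= Aa Bb hE] ab_uniq]] := AB1 h I.
  exists (2 * a, 2 * b + 1); split.
    by split=> /=; [exists a | right; exists b | lia].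
  move=> [_ _] [/= [a' Aa' <-] [] [b' Bb' <-] gE']; first by exfalso; lia.
  by have [-> ->] : (a, b) = (a', b') by apply: ab_uniq; split=> //=; lia.
Qed.

Definition progression (k : nat) (c : int) : set int :=
  [set i%:Z * c | i in [set i | (i < k)%N]].

(** By coprimality the progression meets each residue class mod [k] exactly once. *)
Lemma tiling_progression_multiples (k : nat) (c : int) :
    (0 < k)%N -> coprimez k%:Z c ->
  tiling (progression k c) [set k%:Z * x | x in setT] setT.
Proof.
move=> k_gt0 co_kc; split=> // g _.
have [[u v] /= uv] := coprimezP _ _ co_kc.
(* [v] inverts [c] mod [k], so this [i] solves i c = g mod [k]. *)
pose i := `|((v * g) %% k%:Z)%Z|%N.
have i_val : i%:Z = ((v * g) %% k%:Z)%Z by rewrite gez0_abs ?modz_ge0 //; lia.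
have i_lt : (i < k)%N by rewrite -ltz_nat i_val ltz_pmod //; lia.
have dvd_i : (k%:Z %| g - i%:Z * c)%Z.
  have gE := divz_eq (v * g) k%:Z; rewrite -i_val in gE.
  apply/dvdzP; exists (g * u + (v * g %/ k%:Z)%Z * c).
  have -> : i%:Z = v * g - (v * g %/ k%:Z)%Z * k%:Z.
    by rewrite {1}gE addrC addKr.
  by rewrite -{1}[g]mulr1 -uv; ring.
exists (i%:Z * c, g - i%:Z * c); split.
  split=> /=; [by exists i | | by rewrite addrC subrK].
  by have /dvdzP[x ->] := dvd_i; exists x; rewrite // mulrC.
move=> [_ _] [/= [j /= lt_jk <-] [y _ <-] g_eq].
suff ji : j = i by rewrite g_eq ji addrAC subrr add0r.
have : (k%:Z %| (j%:Z - i%:Z) * c)%Z.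
  have -> : (j%:Z - i%:Z) * c = (g - i%:Z * c) - y * k%:Z by rewrite g_eq; ring.
  by rewrite rpredB ?dvdz_mull.
rewrite Gauss_dvdzl // -eqz_mod_dvd !modz_nat eqz_nat !modn_small //.
by move/eqP.
Qed.

(** The translates of [0, c) by the progression fill [0, kc); the index is the number of the block
    containing g mod kc. *)
Lemma tiling_progression_blocks (k : nat) (c : int) :
    (0 < k)%N -> 0 < c ->
  tiling (progression k c) [set x | (x %% (k%:Z * c))%Z < c] setT.
Proof.
move=> k_gt0 c_gt0; split=> // g _.
have kc_gt0 : 0 < k%:Z * c by rewrite mulr_gt0.
have block_eq (i : nat) : (i < k)%N ->
    ((g - i%:Z * c) %% (k%:Z * c))%Z < c -> i%:Z = ((g %% (k%:Z * c))%Z %/ c)%Z.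
  move=> lt_ik; set s := (_ %% _)%Z => lt_sc.
  have s_ge0 : 0 <= s by rewrite modz_ge0 ?gt_eqF.
  have -> : (g %% (k%:Z * c))%Z = i%:Z * c + s.
    rewrite -[g](subrK (i%:Z * c)) -modzDml -/s modz_small.
      by rewrite addrC.
    have : (i.+1%:Z * c <= k%:Z * c) by rewrite ler_pM2r.
    rewrite -addn1 PoszD mulrDl mul1r => le_kc.
    by rewrite addr_ge0 ?mulr_ge0 ?(ltW c_gt0) //=; lia.
  by rewrite divzMDl ?gt_eqF // divz_small ?addr0 // s_ge0 abszE gtr0_norm.
pose r := (g %% (k%:Z * c))%Z.
have r_ge0 : 0 <= r by rewrite modz_ge0 ?gt_eqF.
have r_lt : r < k%:Z * c by rewrite ltz_pmod.
pose i := `|(r %/ c)%Z|%N.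
have i_val : i%:Z = (r %/ c)%Z by rewrite gez0_abs // divz_ge0.
have lt_ik : (i < k)%N by rewrite -ltz_nat i_val ltz_divLR // .
exists (i%:Z * c, g - i%:Z * c); split.
  split=> /=; [by exists i | | by rewrite addrC subrK].
  have -> : g - i%:Z * c = (g %/ (k%:Z * c))%Z * (k%:Z * c) + (r %% c)%Z.
    rewrite {1}(divz_eq g (k%:Z * c)) -/r {1}(divz_eq r c) -i_val.
    by rewrite addrA addrAC addrK.
  rewrite modzMDl modz_small ?ltz_pmod // modz_ge0 ?gt_eqF //=.
  by apply: lt_le_trans (ltz_pmod _ c_gt0) _; rewrite ler_peMl ?(ltW c_gt0).
move=> [_ b] [/= [j /= lt_jk <-] lt_b g_eq].
have j_i : j%:Z = i%:Z.
  by rewrite i_val; apply: block_eq => //; rewrite g_eq addrAC subrr add0r.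
by rewrite j_i g_eq j_i addrAC subrr add0r.
Qed.

(** The set contains 0, hence t and -t for any period t. If r = t mod kc were nonzero, both r and kc
    - r would be below c, against kc >= 2c. *)
Lemma block_periodP (k : nat) (c t : int) : (1 < k)%N -> 0 < c ->
  is_translation_period [set x | (x %% (k%:Z * c))%Z < c] t <->
  (k%:Z * c %| t)%Z.
Proof.
move=> k_gt1 c_gt0; rewrite translation_periodP; set m := k%:Z * c.
split=> [t_per | /dvdzP[q ->] x]; last by rewrite /= -mulNr addrC modzMDl.
have m_gt0 : 0 < m by rewrite mulr_gt0 //; lia.
have mc : c + c <= m by rewrite /m; nia.
have lt_Nt : (- t %% m)%Z < c.
  by rewrite -sub0r; apply: (proj1 (t_per 0)); rewrite /= mod0z.
have lt_t : (t %% m)%Z < c by apply: (proj2 (t_per t)); rewrite /= subrr mod0z.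
apply/dvdz_mod0P.
have t_ge0 : 0 <= (t %% m)%Z by rewrite modz_ge0 ?gt_eqF.
apply/eqP; apply: contraT => t_neq0; move: lt_Nt.
suff -> : (- t %% m)%Z = m - (t %% m)%Z by lia.
rewrite {1}(divz_eq t m) opprD -mulNr modzMDl.
rewrite -(modzMDl 1) mul1r modz_small //; lia.
Qed.

Lemma scaled_block_periodP (l k : nat) (c t : int) :
    (0 < l)%N -> (1 < k)%N -> 0 < c ->
  is_translation_period
    [set l%:Z * x | x in [set x | (x %% (k%:Z * c))%Z < c]] t <->
  (l%:Z * (k%:Z * c) %| t)%Z.
Proof.
move=> l_gt0 k_gt1 c_gt0; have l_neq0 : l%:Z != 0 by lia.
set F := [set x | _].
have lF x : [set l%:Z * x | x in F] (l%:Z * x) <-> F x.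
  by split=> [[y Fy /(mulfI l_neq0) <-] | Fx]; last exists x.
suff scaleP s : is_translation_period [set l%:Z * x | x in F] (l%:Z * s) <->
    is_translation_period F s.
  split=> [t_per | /dvdzP[q ->]]; last first.
    by rewrite mulrCA; apply/scaleP/block_periodP => //; rewrite dvdz_mull.
  (* The set contains 0 and only multiples of [l], so -t is such a multiple. *)
  have [s ts] : exists s, t = l%:Z * s.
    have /translation_periodP /(_ 0)[+ _] := t_per; case.
      by exists 0; rewrite ?mulr0 // /F /= mod0z.
    by move=> y _ yt; exists (- y); lia.
  rewrite ts dvdz_mul2l //.
  by apply/block_periodP => //; apply/scaleP; rewrite -ts.
rewrite !translation_periodP; split=> [ls_per x | s_per x].
  by rewrite -lF ls_per -mulrBr lF.
split=> [[y Fy <-] | [y Fy yx]].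
  by rewrite -mulrBr lF -s_per.
have -> : x = l%:Z * (y + s) by rewrite mulrDr yx subrK.
by rewrite lF s_per addrK.
Qed.

Lemma even_odd_periodP (B0 B1 : set int) (t : int) :
  is_translation_period
    ([set 2 * b | b in B0] `|` [set 2 * b + 1 | b in B1]) (2 * t) <->
  is_translation_period B0 t /\ is_translation_period B1 t.
Proof.
set B := _ `|` _.
have B_even x : B (2 * x) <-> B0 x.
  split=> [[] [y By yx] | Bx]; [|exfalso; lia|by left; exists x].
  by rewrite (_ : x = y) //; lia.
have B_odd x : B (2 * x + 1) <-> B1 x.
  split=> [[] [y By yx] | Bx]; [exfalso; lia| |by right; exists x].
  by rewrite (_ : x = y) //; lia.
rewrite !translation_periodP; split=> [t_per | [t_per0 t_per1] x].
  by split=> x; [rewrite -!B_even t_per mulrBr |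
                 rewrite -!B_odd t_per mulrBr addrAC].
have [xE|xE] : x = 2 * (x %/ 2)%Z \/ x = 2 * (x %/ 2)%Z + 1 by lia.
- by rewrite xE -mulrBr !B_even -t_per0.
- by rewrite xE addrAC -mulrBr !B_odd -t_per1.
Qed.

Lemma translation_period_double (B : set int) (t : int) :
  is_translation_period B t -> is_translation_period B (2 * t).
Proof.
rewrite !translation_periodP => t_per x.
by rewrite t_per t_per -addrA -opprD mulrDl mul1r.
Qed.

Lemma least_periodP (B : set int) (t : nat) :
  (0 < t)%N -> is_translation_period B t%:Z ->
  is_least_period B (least_period B).
Proof.
move=> t_gt0 t_per; apply: xgetPex.
have ex_per : exists n : nat,
    (0 < n)%N && asbool (is_translation_period B n%:Z).
  by exists t; rewrite t_gt0; apply/asboolP.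
case: (ex_minnP ex_per) => n /andP[n_gt0 /asboolP n_per] n_min.
exists n; split=> // s s_gt0 s_per; apply: n_min.
by rewrite s_gt0; apply/asboolP.
Qed.

Lemma progression_scale (l : int) (k : nat) (c : int) :
  [set l * x | x in progression k c] = progression k (l * c).
Proof.
apply/seteqP; split=> [_ [_ [i ik <-] <-] | _ [i ik <-]].
  by exists i => //; rewrite mulrCA.
by exists (i%:Z * c); [exists i | rewrite mulrCA].
Qed.

(** The first progression fills the residues mod [k], the second tiles the multiples of [k].
    Swapping the roles gives another complement of the same set. *)
Lemma tiling_two_progressions (k l : nat) (a b : int) :
    (0 < k)%N -> (0 < l)%N -> 0 < b -> coprimez k%:Z (l%:Z * a) ->
  tiling
    [set x + y | x in progression k (l%:Z * a) & y in progression l (k%:Z * b)]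
    [set k%:Z * x | x in [set x | (x %% (l%:Z * b))%Z < b]] setT.
Proof.
move=> k_gt0 l_gt0 b_gt0 co_kla.
apply: tiling_sumset (tiling_progression_multiples k_gt0 co_kla) _.
rewrite -progression_scale; apply: tiling_scale; first by lia.
exact: tiling_progression_blocks.
Qed.

Lemma sumsetC (X Y : set int) :
  [set x + y | x in X & y in Y] = [set y + x | y in Y & x in X].
Proof.
by apply/seteqP; split=> _ [x Xx [y Yy <-]]; exists y => //; exists x => //;
  rewrite addrC.
Qed.

Lemma period_bounds_mono (D D' k : nat) :
  (D <= D')%N -> period_bounds D k -> period_bounds D' k.
Proof.
move=> le_DD' [A [B [A_le AB k_le]]]; exists A, B; split=> // a /A_le /=; lia.
Qed.

Lemma period_bounds_pair : period_bounds 1 1.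
Proof.
exists (progression 2 1), [set x | (x %% (2%:Z * 1))%Z < 1]; split.
- by move=> _ [i /= i_lt <-]; lia.
- exact: tiling_progression_blocks.
- have /(@block_periodP 2 1 _ isT isT) per2 : (2%:Z * 1 %| 2%:Z)%Z by [].
  by have [] := @least_periodP _ 2 isT per2.
Qed.

(** Consecutive integers a = 6m + 1 and b = 6m + 2 are coprime, with a odd and b prime to 3; the
    diameter is 2(3a + 4b) = 84m + 22. *)
Lemma period_bounds_quadratic (m : nat) :
  period_bounds (84 * m + 22) (6 * (6 * m + 1) * (6 * m + 2)).
Proof.
pose a : int := (6 * m + 1)%N; pose b : int := (6 * m + 2)%N.
have a_gt0 : 0 < a by lia.
have b_gt0 : 0 < b by lia.
have co_ab : coprimez a b.
  by apply/coprimezP; exists (-1, 1); rewrite /a /b /=; lia.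
pose X := progression 2 (3%:Z * a); pose Y := progression 3 (2%:Z * b).
pose A' := [set x + y | x in X & y in Y].
pose B0 := [set 2%:Z * x | x in [set x | (x %% (3%:Z * b))%Z < b]].
pose B1 := [set 3%:Z * x | x in [set x | (x %% (2%:Z * a))%Z < a]].
have tile0 : tiling A' B0 setT.
  apply: tiling_two_progressions => //.
  by apply/coprimezP; exists (- (9 * m%:Z + 1), 1); rewrite /a /=; lia.
have tile1 : tiling A' B1 setT.
  rewrite /A' sumsetC; apply: tiling_two_progressions => //.
  by apply/coprimezP; exists (- (4 * m%:Z + 1), 1); rewrite /b /=; lia.
have perP t : is_translation_period B0 t /\ is_translation_period B1 t <->
    (6 * (a * b) %| t)%Z.
  rewrite !scaled_block_periodP //.
  split=> [[/dvdzP[q ->]] | /dvdzP[q ->]].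
    rewrite (_ : q * _ = 6 * (q * b)); last by ring.
    rewrite (_ : 3%:Z * _ = 6 * a); last by ring.
    rewrite !dvdz_mul2l // Gauss_dvdzl // => /dvdzP[r ->].
    by rewrite -mulrA dvdz_mull.
  by split; apply/dvdzP; [exists (q * a) | exists (q * b)]; ring.
exists [set 2 * x | x in A'],
  ([set 2 * x | x in B0] `|` [set 2 * x + 1 | x in B1]).
split.
- move=> _ [_ [_ [i /= i_lt <-] [_ [j /= j_lt <-] <-]] <-]; rewrite /a /b /=.
  by case: i i_lt => [|[|]] // _; case: j j_lt => [|[|[|]]] // _; lia.
- exact: tiling_even_odd.
set B := _ `|` _.
have B_per : is_translation_period B (2 * (6 * (a * b))).
  by apply/even_odd_periodP/perP.
have [l_gt0 l_per _] : is_least_period B (least_period B).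
  apply: (@least_periodP _ (2 * (6 * ((6 * m + 1) * (6 * m + 2))))).
    by lia.
  by rewrite !PoszM.
(* The least period may be odd; its double is an even shift, which acts on each parity class
   separately. *)
have /even_odd_periodP/perP := translation_period_double l_per.
rewrite /a /b -!PoszM mulnA; exact: dvdn_leq.
Qed.

(** * Bounds for the maximal period *)

Lemma period_bounds_upper (D k : nat) : period_bounds D k ->
  exists t, (t * t.-1 <= 2 * D)%N /\ (k <= (2 * D ^ 2) ^ t)%N.
Proof.
move=> [A [B [A_le AB]]]; rewrite /least_period.
(* Without a least period the default 0 forces k = 0, and t = 0 serves. *)
case: xgetP => [M _ [M_gt0 M_per M_min] k_le | _ k_le]; last first.
  by exists 0%N; split; [|apply: leq_trans k_le _].
have d_ex p : exists d, p \in primes M ->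
    [/\ d %| M, ~~ (d %| M %/ p) & exists2 z : algC,
      d.-primitive_root z & root (map_poly ratr (mask D A)) z]%N.
  have [pM|] := boolP (p \in primes M); last by exists 0%N.
  have := pM; rewrite mem_primes => /and3P[p_pr _ p_dv].
  have [|d dP] := full_order_root A_le AB M_gt0 M_per (p := p);
    last by exists d.
  (* M / p is positive and smaller than the least period [M], so it is not a period. *)
  move/M_min; rewrite divn_gt0 ?prime_gt0 // dvdn_leq // leqNgt.
  by rewrite ltn_Pdiv ?prime_gt1 // => /(_ isT).
have [d dP] := choice d_ex.
have mask_neq0 : mask D A != 0.
  have [_ /(_ 0 I)[[a b] [[/= Aa _ _] _]]] := AB.
  have /= a_bnd := A_le a Aa.
  have a_abs : `|a|%N%:Z = a by lia.
  apply/eqP => /(congr1 (fun q : {poly rat} => q`_(`|a|%N))).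
  by rewrite coef0 coef_poly ifT ?a_abs ?asboolT //; lia.
have sum_le : (\sum_(e <- undup [seq d p | p <- primes M]) totient e <= D)%N.
  have := leq_sum_totient mask_neq0 (undup_uniq [seq d p | p <- primes M]).
  move=> H; rewrite -ltnS; apply: leq_trans (H _) (size_poly _ _).
  by move=> e; rewrite mem_undup => /mapP[p /dP[_ _ ?] ->].
have [|t [tD Mt]] := leq_prod_full_divisors M_gt0 _ sum_le.
  by move=> p /dP[].
by exists t; split=> //; apply: leq_trans Mt.
Qed.

Lemma max_periodP (D : nat) : (0 < D)%N ->
  period_bounds D (max_period D) /\
  (forall k, period_bounds D k -> (k <= max_period D)%N).
Proof.
move=> D_gt0.
(* t(t - 1) <= 2D gives t <= 2D + 1, a crude bound that suffices for the maximum to exist. *)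
have bound k : asbool (period_bounds D k) -> (k <= (2 * D ^ 2) ^ (2 * D).+1)%N.
  move=> /asboolP/period_bounds_upper[t [tD /leq_trans]]; apply.
  have base_gt0 : (0 < 2 * D ^ 2)%N by rewrite muln_gt0 expn_gt0 D_gt0.
  apply: leq_pexp2l => //; case: t tD => // t; nia.
have ex_k : exists k, asbool (period_bounds D k).
  by exists 1%N; apply/asboolP/(period_bounds_mono D_gt0 period_bounds_pair).
case: (ex_maxnP ex_k bound) => k /asboolP Dk k_max.
suff /(xgetPex 0%N) : exists k, [set k | period_bounds D k /\
    forall j : nat, period_bounds D j -> (j <= k)%N] k by [].
by exists k; split=> // j /asboolP; apply: k_max.
Qed.

Lemma max_period_quadratic (D : nat) :
  (0 < D)%N -> (D ^ 2 <= 105 ^ 2 * max_period D)%N.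
Proof.
move=> D_gt0; have [_ D_max] := max_periodP D_gt0.
have [D_lt|D_ge] := ltnP D 22.
  have := D_max _ (period_bounds_mono D_gt0 period_bounds_pair); nia.
(* The largest m with 84m + 22 <= D; then D <= 84m + 105 <= 105(m + 1). *)
pose m := ((D - 22) %/ 84)%N.
have mD : (84 * m + 22 <= D)%N by lia.
have Dm : (D <= 105 * m.+1)%N by lia.
have := D_max _ (period_bounds_mono mD (period_bounds_quadratic m)).
move=> le_max; apply: leq_trans (leq_mul (leqnn _) le_max).
apply: leq_trans (_ : _ <= (105 * m.+1) ^ 2)%N _; first by rewrite leq_exp2r.
by rewrite expnMn leq_mul2l; apply/orP; right; rewrite -mulnn; nia.
Qed.

End Periods.

(** For D >= 2, 2D^2 <= D^3, and t(t - 1) <= 2D gives t^2 <= 4D; the exponent 3t is thus at most 6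
    sqrt D. *)
Lemma max_period_exp (R : realType) (D : nat) : (2 <= D)%N ->
  (max_period D)%:R <= expR (6 * Num.sqrt D%:R * ln D%:R) :> R.
Proof.
move=> D_ge2; have D_gt0 : (0 < D)%N by lia.
have [/period_bounds_upper[t [tD le_t]] _] := max_periodP D_gt0.
have D_gt0R : 0 < D%:R :> R by rewrite ltr0n.
have lnD_ge0 : 0 <= ln D%:R :> R by rewrite ln_ge0 // ler1n.
have le_pow : (max_period D <= D ^ (3 * t))%N.
  apply: leq_trans le_t _; rewrite expnM.
  have [-> //|t_gt0] := posnP t.
  by rewrite leq_exp2r // [(D ^ 3)%N]expnS leq_mul2r D_ge2 orbT.
apply: (@le_trans _ _ (D%:R ^+ (3 * t))); first by rewrite -natrX ler_nat.
rewrite -[X in X ^+ _]lnK ?posrE // -expRM_natl ler_expR.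
apply: ler_wpM2r => //; rewrite natrM.
suff : t%:R <= 2 * Num.sqrt D%:R :> R by lra.
rewrite -(@ler_pXn2r _ 2) ?nnegrE ?mulr_ge0 ?sqrtr_ge0 //.
rewrite exprMn sqr_sqrtr ?(ltW D_gt0R) // -!natrX -natrM ler_nat.
by nia.
Qed.

Lemma ln3_gt1 (R : realType) : 1 < ln 3 :> R.
Proof.
rewrite -ltr_expR lnK ?posrE //.
(* exp(1) <= (6/5)^6 < 3 *)
have exp_ge : 5 / 6 <= expR (- 6%:R^-1) :> R.
  by apply: le_trans (expR_ge1Dx _); lra.
have : (5 / 6) ^+ 6 <= (expR 1)^-1 :> R.
  rewrite -expRN (_ : -1 = 6%:R * (- 6%:R^-1)); last by field.
  by rewrite expRM_natl lerXn2r ?nnegrE ?expR_ge0 //; lra.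
move=> exp1_ge; rewrite -ltf_pV2 ?posrE ?expR_gt0 //.
apply: lt_le_trans exp1_ge; lra.
Qed.

Theorem theorem1 (R : realType) :
  exists c1 c2 c3 : R,
    [/\ [/\ 0 < c1, 0 < c2 & 0 < c3],
        forall D : nat, (1 <= D)%N ->
          c1 * D%:R ^+ 2 <= (max_period D)%:R &
        forall D : nat, (3 <= D)%N ->
          (max_period D)%:R <=
            c2 * expR (c3 * Num.sqrt D%:R * ln D%:R * Num.sqrt (ln (ln D%:R)))].
Proof.
pose s (n : nat) : R := Num.sqrt (ln (ln n%:R)).
(* Since ln 3 > 1, the factor sqrt(ln ln D) is at least its positive value at 3, which [c3]
   absorbs. *)
have s3_gt0 : 0 < s 3%N by rewrite sqrtr_gt0 ln_gt0 ?ln3_gt1.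
exists (105 ^- 2), 1, (6 / s 3%N); split.
- by rewrite invr_gt0 exprn_gt0 // ltr01 divr_gt0.
- move=> D D_ge1; rewrite mulrC ler_pdivrMr ?exprn_gt0 // mulrC.
  by rewrite -!natrX -natrM ler_nat max_period_quadratic.
- move=> D D_ge3; rewrite mul1r.
  apply: le_trans (max_period_exp R (ltnW D_ge3)) _.
  have lnD_ge : ln 3 <= ln D%:R :> R.
    by rewrite ler_ln ?posrE ?ltr0n ?ler_nat // ltnW // ltnW.
  have ln3 := ln3_gt1 R.
  have s_le : s 3%N <= s D.
    by rewrite ler_wsqrtr // ler_ln ?posrE //; [lra|lra].
  rewrite ler_expR -[leLHS]mulr1.
  have -> : 6 / s 3%N * Num.sqrt D%:R * ln D%:R * s D =
      6 * Num.sqrt D%:R * ln D%:R * (s D / s 3%N).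
    by field; rewrite gt_eqF.
  apply: ler_wpM2l; last by rewrite ler_pdivlMr // mul1r.
  by rewrite !mulr_ge0 ?sqrtr_ge0 //; lra.
Qed.
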